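(* For every nonzero real number $x$, $$\left.\frac{\partial \mathrm{Wi}_{\alpha,\beta}(x)}{\partial\alpha}\right|_{\alpha=1,\ \beta=0}=\frac12\left\{I_0(2\sqrt x)-\sqrt x\left[\ln x\,I_1(2\sqrt x)-2K_1(2\sqrt x)\right]\right\}-1.$$
   Context: The integral Wright function is $\mathrm{Wi}_{\alpha,\beta}(x)=\sum_{k=1}^\infty\frac{x^k}{k\,k!\,\Gamma(\alpha k+\beta)}$ (with $1/\Gamma=0$ at the poles of $\Gamma$), so that $\frac{\partial \mathrm{Wi}_{\alpha,\beta}(x)}{\partial\alpha}=-\sum_{k=1}^\infty\frac{\psi(\alpha k+\beta)}{k!\,\Gamma(\alpha k+\beta)}x^k$, with $\psi=\Gamma'/\Gamma$ the digamma function. $I_\nu$ and $K_\nu$ are the modified Bessel functions of the first and second kind. For $x<0$, $\ln x$ and $\sqrt x$ denote principal branches. *)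

(* Defs.v *)
From mathcomp Require Import all_boot all_order all_algebra.
From mathcomp Require Import all_classical all_reals all_analysis.
From mathcomp.real_closed Require Export complex.

Set Implicit Arguments.
Unset Strict Implicit.
Unset Printing Implicit Defensive.

Import Order.TTheory GRing.Theory Num.Theory.
Import numFieldNormedType.Exports.

Local Open Scope classical_set_scope.
Local Open Scope ring_scope.
Local Open Scope complex_scope.

Definition eulerGamma (R : realType) (x : R) : R :=
  \int[lebesgue_measure]_(t in `]0, +oo[) (t `^ (x - 1) * expR (- t)).

(* Extended to x <= 0 by Gamma (x + 1) = x * Gamma x, the shift n being the least
   one with 0 < x + n.  At a pole one factor of the product is 0, so Gamma gets
   the junk value x / 0 = 0; as 0^-1 = 0, rGamma = 1 / Gamma vanishes there, as
   it should. *)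
Definition Gamma (R : realType) (x : R) : R :=
  let n := Num.truncn (1 - x) in
  eulerGamma (x + n%:R) / \prod_(i < n) (x + i%:R).

Definition rGamma (R : realType) (x : R) : R := (Gamma x)^-1.

Definition Wi (R : realType) (alpha beta x : R) : R :=
  limn [series x ^+ k.+1 / (k.+1%:R * (k.+1)`!%:R) *
         rGamma (alpha * k.+1%:R + beta)]_k.

(* Principal argument, with values in ]-pi, pi]. *)
Definition carg (R : realType) (z : R[i]) : R :=
  let t := acos (complex.Re z / complex.Re `|z|) in if 0 <= complex.Im z then t else - t.

Definition clog (R : realType) (z : R[i]) : R[i] := ln (complex.Re `|z|) +i* carg z.

Definition cexp (R : realType) (z : R[i]) : R[i] :=
  (expR (complex.Re z))%:C * (cos (complex.Im z) +i* sin (complex.Im z)).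

(* Principal value of z ^ nu; the case z = 0 is as in powR. *)
Definition cpow (R : realType) (z : R[i]) (nu : R) : R[i] :=
  if z == 0 then (nu == 0)%:R else cexp (nu%:C * clog z).

(* R[i]^o is R[i] with the topology given by the modulus. *)
Definition besselI (R : realType) (nu : R) (z : R[i]) : R[i] :=
  cpow (z / 2%:R) nu *
  limn ([series (z / 2%:R) ^+ (2 * k) *
         (rGamma (nu + k%:R + 1) / k`!%:R)%:C]_k : nat -> R[i]^o).

(* The defining quotient for non-integer order; integer orders are given by its
   limit in nu. *)
Definition besselK_nonint (R : realType) (nu : R) (z : R[i]) : R[i] :=
  (pi / 2%:R)%:C * (besselI (- nu) z - besselI nu z) / (sin (nu * pi))%:C.

Definition besselK (R : realType) (nu : R) (z : R[i]) : R[i] :=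
  if nu \is a Num.int
  then lim ((besselK_nonint mu z : R[i]^o) @[mu --> nu^'])
  else besselK_nonint nu z.

(* Main.v *)
Require Import Defs.
From mathcomp Require Import all_boot all_order all_algebra.
From mathcomp Require Import all_classical all_reals all_analysis.
From mathcomp Require Import measurable_realfun ring lra.

Import Order.TTheory GRing.Theory Num.Theory.
Import numFieldNormedType.Exports.

Local Open Scope classical_set_scope.
Local Open Scope ring_scope.
Local Open Scope complex_scope.

(** Write g = 1 / Gamma, an everywhere differentiable function, and let
      S(mu) = sum_k x^k / k! * g(mu + k + 1),
    the Bessel-Clifford function ([clifford]).  Both sides of the identity are
    equal to S'(-1) - 1.

    Left side.  The terms of Wi_{alpha, 0}(x) are x^k / (k k!) * g(alpha k) with
    k >= 1; differentiating term by term at alpha = 1 leaves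
    sum_{k >= 1} x^k / k! * g'(k), which is S'(-1) without its term of index 0,
    namely g'(0) = g(1) = 1 ([is_derive_Wi]).

    Right side.  With s = sqrt x and L = ln s one has ln x = 2 L and
    I_mu(2 s) = s^mu S(mu) ([besselI_sqrtc]), where s^mu = exp (mu L).  The
    quotient that defines K_1 in the limit has a numerator
    s^(-mu) S(-mu) - s^mu S(mu) vanishing at mu = 1, so that the limit is a ratio
    of derivatives ([besselK1_sqrtc]):
      K_1(2 s) = (s^-1 (L S(-1) + S'(-1)) + s (L S(1) + S'(1))) / 2.
    The recurrence g(y) = y g(y + 1), and the one that it gives for g' by
    differentiation, become S(-1) = x S(1) ([clifford_N1]) and
    S'(-1) - S(0) = x S'(1) ([dclifford_N1]).  In the right side of the theorem
    the logarithms then cancel, and so do the two occurrences of S(0).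

    The analytic content is in two facts.  First, g is differentiable and grows,
    together with g', at most polynomially on [-1, +oo[ ([rGamma_bound]).  By
    differentiation under the integral sign and 1 - 1/t <= ln t <= t - 1,
      Gamma y - Gamma (y - 1) <= Gamma' y <= Gamma (y + 1) - Gamma y  for y > 1,
    which with Gamma (y + 1) = y Gamma y gives Gamma >= 1 and |g'(y)| <= y on
    [2, +oo[; the recurrence for g carries the bounds down to -1.  Second, a
    series of differentiable functions with summable derivative bounds may be
    differentiated term by term ([is_derive_series]), by dominated convergence of
    the difference quotients; the factorials in the coefficients absorb the
    polynomial growth of g and g'. *)

(** * The functional equation of the Gamma integral *)

Lemma cvg_powR_expRN {R : realType} (y : R) :
  (t `^ y * expR (- t)) @[t --> +oo] --> (0 : R).
Proof.
(* t ^ y <= t ^ k for t >= 1, and t ^ (k + 1) / (k + 1)! <= e ^ t. *)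
pose k := (Num.truncn y).+1.
have yk : y <= k%:R by apply/ltW; rewrite /k; exact: truncnS_gt.
apply: (@squeeze_cvgr _ _ _ _ (cst 0) (fun t => (k.+1)`!%:R * t^-1)).
- near=> t.
  have t1 : 1 <= t by near: t; exact: nbhs_pinfty_ge.
  have t0 : 0 < t by exact: lt_le_trans t1.
  rewrite /= mulr_ge0 ?powR_ge0 ?expR_ge0//=.
  rewrite expRN ler_pdivrMr ?expR_gt0//.
  apply: (@le_trans _ _ (t ^+ k)).
    by rewrite -powR_mulrn ?(ltW t0)// ler_powR.
  rewrite mulrAC ler_pdivlMr// -exprSr -ler_pdivrMl ?ltr0n ?fact_gt0//.
  rewrite mulrC; apply: le_trans (expR_ge1Dxn k (ltW t0)).
  by rewrite lerDr ler01.
- exact: cvg_cst.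
- rewrite -(mulr0 (k.+1)`!%:R); apply: cvgMl_tmp.
  by apply/gtr0_cvgV0; [exact: nbhs_pinfty_gt|exact: cvg_id].
Unshelve. all: end_near. Qed.

Definition gammaf {R : realType} (y t : R) : R := t `^ (y - 1) * expR (- t).

Lemma gammaf_ge0 {R : realType} (y t : R) : 0 <= gammaf y t.
Proof. by rewrite mulr_ge0 ?powR_ge0 ?expR_ge0. Qed.

Lemma continuous_gammaf {R : realType} (y : R) :
  {in `]0, +oo[, continuous (gammaf y)}.
Proof.
move=> t; rewrite in_itv/= andbT => t0; apply: cvgM.
  apply: (@differentiable_continuous _ _ _ t (fun x => x `^ (y - 1))).
  by apply/derivable1_diffP/derivable_powR; rewrite in_itv/= t0.
apply: continuous_comp; first exact: opp_continuous.
exact: continuous_expR.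
Qed.

Lemma measurable_gammaf {R : realType} (y : R) :
  measurable_fun (`]0, +oo[%classic : set R) (gammaf y).
Proof.
apply: open_continuous_measurable_fun; first exact: interval_open.
by move=> t; rewrite inE => t0; apply: continuous_gammaf.
Qed.

(** Compact intervals exhausting ]0, +oo[, away from the singularity of the
    integrand at 0, on which integration by parts applies. *)
Definition gammaitv {R : realType} (n : nat) : set R :=
  `[(n.+2%:R)^-1, n.+2%:R]%classic.

Lemma nondecreasing_gammaitv {R : realType} : nondecreasing_seq (@gammaitv R).
Proof.
move=> m n mn; apply/subsetPset => t; rewrite /gammaitv/= !in_itv/= => /andP[h1 h2].
apply/andP; split.
  by apply: le_trans h1; rewrite lef_pV2 ?posrE ?ltr0n// ler_nat !ltnS.
by apply: (le_trans h2); rewrite ler_nat !ltnS.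
Qed.

Lemma bigcup_gammaitv {R : realType} :
  \bigcup_n @gammaitv R n = `]0, +oo[%classic.
Proof.
apply/seteqP; split => t /=.
  move=> [n _]; rewrite /gammaitv/= !in_itv/= andbT => /andP[+ _].
  by apply: lt_le_trans; rewrite invr_gt0 ltr0n.
rewrite in_itv/= andbT => t0.
exists (maxn (Num.truncn t) (Num.truncn t^-1)) => //; rewrite /gammaitv/= in_itv/=.
apply/andP; split.
  rewrite -[leRHS]invrK lef_pV2 ?posrE ?ltr0n// ?invr_gt0//.
  apply/ltW/(lt_le_trans (truncnS_gt _)); rewrite ler_nat ltnS.
  exact: leqW (leq_maxr _ _).
apply/ltW/(lt_le_trans (truncnS_gt _)); rewrite ler_nat ltnS.
exact: leqW (leq_maxl _ _).
Qed.

Lemma cvg_gammaitv {R : realType} (y : R) :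
  (\int[lebesgue_measure]_(t in @gammaitv R n) (gammaf y t)%:E)%E @[n --> \oo] -->
  (\int[lebesgue_measure]_(t in `]0%R, +oo[%classic : set R) (gammaf y t)%:E)%E.
Proof.
rewrite -bigcup_gammaitv; apply: ge0_nondecreasing_set_cvg_integral.
- exact: nondecreasing_gammaitv.
- by move=> n; exact: measurable_itv.
- move=> n; apply/measurable_EFinP; apply: measurable_funS (measurable_gammaf y) => //.
  by rewrite -bigcup_gammaitv; exact: bigcup_sup.
- by move=> n t _; rewrite lee_fin gammaf_ge0.
Qed.

(** Extended-real valued, so that the functional equation can be stated, and used
    to prove finiteness, before finiteness is known. *)
Definition gammaI {R : realType} (y : R) : \bar R :=
  (\int[lebesgue_measure]_(t in `]0%R, +oo[%classic : set R) (gammaf y t)%:E)%E.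

Lemma is_derive_expRN {R : realType} (t : R) :
  is_derive t 1 (fun t => - expR (- t)) (expR (- t)).
Proof.
have h : is_derive t 1 (expR \o -%R) (expR (- t) * - 1) by apply: is_derive1_comp.
by apply: (is_derive_eq (is_deriveN h)); rewrite mulrN1 opprK.
Qed.

Lemma gammaitv_by_parts {R : realType} (y : R) (n : nat) : 0 < y ->
  (\int[lebesgue_measure]_(t in gammaitv n) (gammaf (y + 1) t)%:E =
   ((n.+2%:R^-1) `^ y * expR (- n.+2%:R^-1) - n.+2%:R `^ y * expR (- n.+2%:R))%:E
   + y%:E * \int[lebesgue_measure]_(t in gammaitv n) (gammaf y t)%:E)%E.
Proof.
move=> y0.
set a : R := n.+2%:R^-1; set b : R := n.+2%:R.
have a0 : 0 < a by rewrite invr_gt0 ltr0n.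
have ab : a < b.
  by apply: (@lt_le_trans _ _ 1); rewrite ?invf_lt1 ?ltr1n ?ler1n ?ltr0n.
have pos t : t \in `[a, b] -> 0 < t.
  by rewrite in_itv/= => /andP[+ _]; apply: lt_le_trans.
have poso t : t \in `]a, b[ -> 0 < t.
  by rewrite in_itv/= => /andP[+ _]; apply: lt_trans.
have dF (z t : R) : 0 < t -> derivable (fun t => t `^ z) t 1.
  by move=> t0; apply: derivable_powR; rewrite in_itv/= t0.
have cF (z t : R) : 0 < t -> {for t, continuous (fun t => t `^ z)}.
  by move=> t0; apply: differentiable_continuous; apply/derivable1_diffP/dF.
have dG (t : R) : derivable (fun t => - expR (- t)) t 1.
  by apply: ex_derive; exact: is_derive_expRN.
have cG (t : R) : {for t, continuous (fun t => - expR (- t))}.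
  by apply: differentiable_continuous; apply/derivable1_diffP/dG.
have := @integration_by_parts R (fun t => t `^ y) (fun t => - expR (- t))
  (fun t => y * t `^ (y - 1)) (fun t => expR (- t)) a b ab.
have -> : (\int[lebesgue_measure]_(t in gammaitv n) (gammaf (y + 1) t)%:E =
  \int[lebesgue_measure]_(x in `[a, b]) (x `^ y * expR (- x))%:E)%E.
  by apply: eq_integral => t _; rewrite /gammaf addrK.
move=> ->.
- rewrite (_ : _ `^ y * _ - _ =
    b `^ y * - expR (- b) - a `^ y * - expR (- a)); last by ring.
  congr (_ + _)%E.
  rewrite -ge0_integralZl_EFin ?(ltW y0)//; last 3 first.
  + exact: measurable_itv.
  + by move=> t _; rewrite lee_fin gammaf_ge0.
  + apply/measurable_EFinP; apply: measurable_funS (measurable_gammaf y) => //.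
    by rewrite -bigcup_gammaitv; exact: bigcup_sup.
  rewrite -[RHS]oppeK -integral_ge0N/=; last first.
    by move=> t tab; rewrite lee_fin mulr_ge0 ?(ltW y0) ?gammaf_ge0.
  congr (- _)%E; apply: eq_integral => t _; rewrite /gammaf; congr EFin; ring.
- apply: derivable_within_continuous => t tab.
  by apply: derivableM => //; apply: dF; exact: pos.
- split.
  + by move=> t tab; apply: dF; exact: poso.
  + by apply/cvg_at_right_filter/cF.
  + by apply/cvg_at_left_filter/cF/(lt_trans a0).
- by move=> t /poso t0; rewrite powR_derive1// in_itv/= t0.
- apply: continuous_subspaceT => t; apply: continuous_comp; first exact: opp_continuous.
  exact: continuous_expR.
- split.
  + by move=> t tab; apply: dG.
  + by apply/cvg_at_right_filter/cG.
  + by apply/cvg_at_left_filter/cG.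
- by move=> t _; rewrite derive1E; apply: derive_val; exact: is_derive_expRN.
Qed.

(** The integrand is nonnegative, so the integrals over the exhausting intervals
    converge monotonically on both sides of the integration by parts, while the
    boundary terms vanish in the limit. *)
Lemma gammaI_add1 {R : realType} (y : R) : 0 < y ->
  gammaI (y + 1) = (y%:E * gammaI y)%E.
Proof.
move=> y0; have hL := cvg_gammaitv (y + 1).
have hR := cvgeZl (isT : y%:E \is a fin_num) (cvg_gammaitv y).
apply: (cvg_unique _ hL) => //=.
under eq_fun do rewrite gammaitv_by_parts//.
rewrite -(add0e (y%:E * gammaI y)%E); apply: cvgeD => //.
apply: cvg_EFin; first exact: nearW.
rewrite /= -(subrr (0 : R)).
have cn : (n.+2%:R : R) @[n --> \oo] --> +oo.
  have := @cvgr_idn R; rewrite -(cvg_shiftn 2).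
  by under eq_fun do rewrite addn2.
apply: cvgB.
- apply: (@squeeze_cvgr _ _ _ _ (cst 0) (fun n => (n.+2%:R^-1 : R) `^ y)).
  + apply: nearW => n; rewrite mulr_ge0 ?powR_ge0 ?expR_ge0//=.
    by rewrite ler_piMr ?powR_ge0// expR_le1 oppr_le0 invr_ge0.
  + exact: cvg_cst.
  + apply: (cvg_at_rightP (fun a : R => a `^ y) 0 0).1.
      exact: powR_cvg0.
    split; first by move=> n; rewrite invr_gt0.
    apply/gtr0_cvgV0 => //; exact: nearW.
- have := cvg_powR_expRN y; move/cvg_pinftyP; exact.
Qed.

Lemma gammaI1 {R : realType} : gammaI 1 = 1%E :> \bar R.
Proof.
rewrite /gammaI integral_itv_obnd_cbnd; last first.
  by apply/measurable_EFinP; exact: measurable_gammaf.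
transitivity (\int[lebesgue_measure]_(t in `[0%R : R, +oo[) (expR (- t))%:E)%E.
  by apply: eq_integral => t _; rewrite /gammaf subrr powRr0 mul1r.
have cE : continuous (fun t : R => expR (- t)).
  move=> t; apply: continuous_comp; first exact: opp_continuous.
  exact: continuous_expR.
have dE (t : R) : derivable (fun t => - expR (- t)) t 1.
  by apply: ex_derive; exact: is_derive_expRN.
rewrite (@ge0_continuous_FTC2y R _ (fun x => - (expR (- x))) _ 0%R)//.
- by rewrite oppr0 expR0 EFinN oppeK add0e.
- by apply: continuous_subspaceT; exact: cE.
- by rewrite -oppr0; apply: cvgN; exact: cvgr_expR.
- apply/cvg_at_right_filter.
  apply: (@differentiable_continuous _ _ _ (0:R) (fun x : R => - expR (- x))).
  exact/derivable1_diffP/dE.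
- by move=> t _; rewrite derive1E; apply: derive_val; exact: is_derive_expRN.
Qed.

Lemma gammaI_ge0 {R : realType} (y : R) : (0 <= gammaI y)%E.
Proof. by apply: integral_ge0 => t _; rewrite lee_fin gammaf_ge0. Qed.

Lemma gammaI_natS {R : realType} (n : nat) : gammaI (n.+1%:R : R) = (n`!%:R)%:E.
Proof.
elim: n => [|n IHn]; first by rewrite gammaI1.
by rewrite -[n.+2]addn1 natrD gammaI_add1// IHn factS natrM.
Qed.

Lemma powR_le_add {R : realType} (u a b t : R) : 0 < t -> a <= u <= b ->
  t `^ u <= t `^ a + t `^ b.
Proof.
move=> t0 /andP[au ub]; have [t1|/ltW t1] := leP t 1.
  by apply: ler_wpDr; [exact: powR_ge0|apply: ger_powR => //; rewrite t0].
by apply: ler_wpDl; [exact: powR_ge0|apply: ler_powR].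
Qed.

Lemma gammaf_le_add {R : realType} (u a b t : R) : 0 < t -> a <= u <= b ->
  gammaf u t <= gammaf a t + gammaf b t.
Proof.
move=> t0 /andP[au ub]; rewrite /gammaf -mulrDl ler_wpM2r ?expR_ge0//.
by apply: powR_le_add => //; rewrite !lerD2r au.
Qed.

(** For y >= 1 the integrand lies below the sum of those at 1 and at an integer
    above y, whose integrals are factorials; the functional equation then
    transfers finiteness from y + 1 to y. *)
Lemma gammaI_fin {R : realType} (y : R) : 0 < y -> gammaI y \is a fin_num.
Proof.
have measg (z : R) : measurable_fun (`]0, +oo[%classic : set R) (EFin \o gammaf z).
  by apply/measurable_EFinP; exact: measurable_gammaf.
have ge1 (z : R) : 1 <= z -> gammaI z \is a fin_num.
  move=> z1; rewrite ge0_fin_numE ?gammaI_ge0//.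
  set n := Num.truncn z.
  have : (gammaI (1%R : R) + gammaI (n.+1%:R%R : R) < +oo)%E.
    by rewrite gammaI1 gammaI_natS -EFinD ltry.
  apply: (le_lt_trans _).
  have mitv : measurable (`]0, +oo[%classic : set R) by exact: measurable_itv.
  have ge0 (u t : R) : `]0, +oo[%classic t -> (0 <= (gammaf u t : R)%:E)%E.
    by rewrite lee_fin gammaf_ge0.
  have -> : (gammaI (1%R : R) + gammaI (n.+1%:R%R : R) =
    \int[lebesgue_measure]_(t in `]0%R, +oo[%classic : set R)
      ((gammaf 1 t)%:E + (gammaf n.+1%:R t)%:E))%E.
    exact: (esym (ge0_integralD lebesgue_measure mitv (ge0 1) (measg 1)
      (ge0 n.+1%:R) (measg n.+1%:R))).
  apply: (@ge0_le_integral _ _ R lebesgue_measure _ mitv) => //.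
  - exact: ge0.
  - exact: measg.
  - by apply: emeasurable_funD; exact: measg.
  - move=> t; rewrite /= in_itv/= andbT => t0; rewrite -EFinD lee_fin.
    by apply: gammaf_le_add => //; rewrite z1 ltW// truncnS_gt.
move=> y0; have := ge1 (y + 1); rewrite gammaI_add1// lerDr => /(_ (ltW y0)).
rewrite ge0_fin_numE ?mule_ge0 ?lee_fin ?(ltW y0) ?gammaI_ge0//.
rewrite ge0_fin_numE ?gammaI_ge0// => h.
by rewrite -(lte_pmul2l (isT : y%:E \is a fin_num) y0); rewrite gt0_muley.
Qed.

Lemma integrable_gammaf {R : realType} (y : R) : 0 < y ->
  lebesgue_measure.-integrable (`]0, +oo[%classic : set R) (EFin \o gammaf y).
Proof.
move=> y0; apply/integrableP; split.
  by apply/measurable_EFinP; exact: measurable_gammaf.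
have := gammaI_fin y y0; rewrite ge0_fin_numE ?gammaI_ge0//.
congr (_ < _)%E; apply: eq_integral => t _ /=.
by rewrite ger0_norm ?gammaf_ge0.
Qed.

Lemma EFin_eulerGamma {R : realType} (y : R) : 0 < y -> (eulerGamma y)%:E = gammaI y.
Proof. by move=> y0; rewrite /eulerGamma /Rintegral fineK// gammaI_fin. Qed.

Lemma eulerGamma_rec {R : realType} (y : R) : 0 < y ->
  eulerGamma (y + 1) = y * eulerGamma y.
Proof.
move=> y0; apply: EFin_inj; rewrite EFinM !EFin_eulerGamma ?gammaI_add1//.
by rewrite addr_gt0.
Qed.

Lemma eulerGamma1 {R : realType} : eulerGamma 1 = 1 :> R.
Proof. by apply: EFin_inj; rewrite EFin_eulerGamma// gammaI1. Qed.

(** * Differentiating the Gamma function *)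

Lemma ln_le_subr1 {R : realType} (t : R) : 0 < t -> ln t <= t - 1.
Proof.
by move=> t0; have := @le_ln1Dx R (t - 1); rewrite subrKC; apply; lra.
Qed.

Lemma ln_ge_1Bdiv {R : realType} (t : R) : 0 < t -> 1 - t^-1 <= ln t.
Proof.
move=> t0; have := @ln_le_subr1 R t^-1; rewrite invr_gt0 lnV ?posrE//.
by move=> /(_ t0); lra.
Qed.

(** The logarithm is dominated by arbitrarily small powers at 0 and at infinity,
    since c ln t = ln (t ^ c) <= t ^ c, and likewise with - c for c. *)
Lemma norm_ln_le {R : realType} (c t : R) : 0 < c -> 0 < t ->
  `|ln t| <= c^-1 * (t `^ c + t `^ (- c)).
Proof.
move=> c0 t0; rewrite ler_norml ler_pdivlMl// -mulNr.
have h1 := ln_le_subr1 (t `^ c) (powR_gt0 c t0).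
have h2 := ln_le_subr1 (t `^ (- c)) (powR_gt0 (- c) t0).
have p1 := powR_gt0 c t0; have p2 := powR_gt0 (- c) t0.
move: h1 h2; rewrite !ln_powR => h1 h2.
apply/andP; split; last by lra.
by rewrite mulNr lerNl -(ler_pM2l c0) mulVKf ?gt_eqF//; lra.
Qed.

Lemma gammafD {R : realType} (y z t : R) : 0 < t ->
  gammaf (y + z) t = t `^ z * gammaf y t.
Proof.
move=> t0; rewrite /gammaf addrAC (@powRD _ t (y - 1) z) ?(gt_eqF t0) ?implybT//; ring.
Qed.

(** Dominates the derivative of the integrand in u uniformly on a whole interval
    of values of u: the logarithm costs an arbitrarily small shift c of the
    exponent. *)
Lemma norm_ln_gammaf_le {R : realType} (a b c u t : R) : 0 < c -> 0 < t ->
  a + c <= u <= b - c ->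
  `|ln t * gammaf u t| <= 2 * c^-1 * (gammaf a t + gammaf b t).
Proof.
move=> c0 t0 /andP[au ub]; rewrite normrM (ger0_norm (gammaf_ge0 _ _)).
apply: le_trans (ler_wpM2r (gammaf_ge0 _ _) (norm_ln_le c t c0 t0)) _.
rewrite -[leLHS]mulrA mulrDl -!gammafD//.
have h1 : gammaf (u + c) t <= gammaf a t + gammaf b t.
  by apply: gammaf_le_add => //; lra.
have h2 : gammaf (u - c) t <= gammaf a t + gammaf b t.
  by apply: gammaf_le_add => //; lra.
rewrite (mulrC 2) -mulrA ler_pM2l ?invr_gt0//; lra.
Qed.

Lemma is_derive_gammaf {R : realType} (y t : R) : 0 < t ->
  is_derive y 1 (gammaf ^~ t) (ln t * gammaf y t).
Proof.
move=> t0.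
have -> : gammaf ^~ t = (fun y => expR (- t)) * (expR \o ((fun=> ln t) * (id - cst 1))).
  apply/funext => z; rewrite /gammaf /= /powR gt_eqF// mulrC.
  by rewrite !fctE/= [_ * ln t]mulrC.
apply: is_derive_eq; rewrite !fctE/= /gammaf /powR gt_eqF//.
rewrite /GRing.scale/= (mulrC (y - 1) (ln t)); ring.
Qed.

Lemma integrable_ln_gammaf_bound {R : realType} (a b k : R) : 0 < a -> 0 < b ->
  lebesgue_measure.-integrable (`]0, +oo[%classic : set R)
    (EFin \o (fun t => k * (gammaf a t + gammaf b t))).
Proof.
move=> a0 b0.
rewrite (_ : _ \o _ =
  (fun t => k%:E * ((EFin \o gammaf a) t + (EFin \o gammaf b) t)%E)%E); last first.
  by apply/funext => t; rewrite /= -EFinD -EFinM.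
apply: integrableZl => //; apply: integrableD => //; exact: integrable_gammaf.
Qed.

Lemma integrable_ln_gammaf {R : realType} (y : R) : 0 < y ->
  lebesgue_measure.-integrable (`]0, +oo[%classic : set R)
    (EFin \o (fun t => ln t * gammaf y t)).
Proof.
move=> y0.
(* A shift by y/2 on either side of y keeps both exponents positive. *)
apply: (le_integrable _ _ _ (integrable_ln_gammaf_bound
  (y / 2) (y + y / 2) (2 * (y / 2)^-1) _ _)).
- exact: measurable_itv.
- apply/measurable_EFinP; apply: measurable_funM; last exact: measurable_gammaf.
  by apply: measurable_funTS; exact: measurable_ln.
- move=> t; rewrite /= in_itv/= andbT => t0; rewrite lee_fin.
  rewrite [leRHS]ger0_norm; last first.
    by rewrite !mulr_ge0 ?invr_ge0 ?addr_ge0 ?gammaf_ge0//; lra.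
  by apply: norm_ln_gammaf_le => //; lra.
- by lra.
- by lra.
Qed.

Lemma is_derive_eulerGamma {R : realType} (y : R) : 0 < y ->
  is_derive y 1 (@eulerGamma R)
    (\int[lebesgue_measure]_(t in `]0, +oo[) (ln t * gammaf y t)).
Proof.
move=> y0.
have Iy : `](y / 2), (y + 1)[%classic y by rewrite /= in_itv/=; lra.
have pos (z : R) : `](y / 2), (y + 1)[%classic z -> 0 < z.
  by rewrite /= in_itv/= => /andP[? _]; lra.
have int z : `](y / 2), (y + 1)[%classic z ->
    lebesgue_measure.-integrable (`]0, +oo[%classic : set R) (EFin \o gammaf z).
  by move=> /pos; exact: integrable_gammaf.
have der (z t : R) : `](y / 2), (y + 1)[%classic z -> (`]0, +oo[%classic : set R) t ->
    derivable (gammaf ^~ t) z 1.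
  move=> _; rewrite /= in_itv/= andbT => t0.
  by apply: ex_derive; exact: is_derive_gammaf.
(* On ]y/2, y + 1[ a shift of the exponent by y/4 stays within [y/4, 2 y + 1]. *)
pose G (t : R) := 2 * (y / 4)^-1 * (gammaf (y / 4) t + gammaf (2 * y + 1) t).
have G0 t : 0 <= G t.
  by rewrite !mulr_ge0 ?invr_ge0 ?addr_ge0 ?gammaf_ge0//; lra.
have intG : lebesgue_measure.-integrable (`]0, +oo[%classic : set R) (EFin \o G).
  by apply: integrable_ln_gammaf_bound; lra.
have ub (z t : R) : `](y / 2), (y + 1)[%classic z -> (`]0, +oo[%classic : set R) t ->
    `|partial1of2 gammaf z t| <= G t.
  rewrite /= !in_itv/= andbT => hz t0; rewrite partial1of2E.
  rewrite (@derive_val _ _ _ _ _ _ _ (is_derive_gammaf z t t0)).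
  by apply: norm_ln_gammaf_le => //; lra.
rewrite (_ : @eulerGamma R =
  fun z => \int[lebesgue_measure]_(t in (`]0, +oo[%classic : set R)) gammaf z t)//.
apply: DeriveDef.
  exact: (@derivable_under_integral R _ _ lebesgue_measure gammaf _
    (measurable_itv _) _ _ _ Iy int der _ G0 intG ub).
rewrite -derive1E.
rewrite [LHS](@differentiation_under_integral R _ _ lebesgue_measure gammaf _
    (measurable_itv _) _ _ _ Iy int der _ G0 intG ub).
apply: eq_Rintegral => t; rewrite inE /= in_itv/= andbT => t0.
by rewrite partial1of2E (@derive_val _ _ _ _ _ _ _ (is_derive_gammaf y t t0)).
Qed.

Lemma gammaf_ge_derive {R : realType} (y t : R) : 0 < t ->
  gammaf y t - gammaf (y - 1) t <= ln t * gammaf y t.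
Proof.
move=> t0; rewrite gammafD// powRN powRr1 ?(ltW t0)// -{1}(mul1r (gammaf y t)) -mulrBl.
by rewrite ler_wpM2r ?gammaf_ge0// ln_ge_1Bdiv.
Qed.

Lemma gammaf_le_derive {R : realType} (y t : R) : 0 < t ->
  ln t * gammaf y t <= gammaf (y + 1) t - gammaf y t.
Proof.
move=> t0; rewrite gammafD// powRr1 ?(ltW t0)// -{3}(mul1r (gammaf y t)) -mulrBl.
by rewrite ler_wpM2r ?gammaf_ge0// ln_le_subr1.
Qed.

Lemma integrable_gammafB {R : realType} (a b : R) : 0 < a -> 0 < b ->
  lebesgue_measure.-integrable (`]0, +oo[%classic : set R)
    (EFin \o (fun t => gammaf a t - gammaf b t)).
Proof.
move=> a0 b0.
rewrite (_ : _ \o _ =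
  (fun t => ((EFin \o gammaf a) t - (EFin \o gammaf b) t)%E)); last first.
  by apply/funext => t; rewrite /= EFinB.
apply: integrableB => //; exact: integrable_gammaf.
Qed.

(** Multiply 1 - 1/t <= ln t <= t - 1 by t^(y-1) e^(-t) and integrate. *)
Lemma derive_eulerGamma_bound {R : realType} (y : R) : 1 < y ->
  eulerGamma y - eulerGamma (y - 1) <= 'D_1 (@eulerGamma R) y
    <= eulerGamma (y + 1) - eulerGamma y.
Proof.
move=> y1; have y0 : 0 < y by lra.
have ym : 0 < y - 1 by lra.
have yp : 0 < y + 1 by lra.
rewrite (@derive_val _ _ _ _ _ _ _ (is_derive_eulerGamma y y0)).
rewrite /eulerGamma -!RintegralB//; try exact: integrable_gammaf.
apply/andP; split; apply: le_Rintegral => //; try exact: integrable_ln_gammaf.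
- exact: integrable_gammafB.
- by move=> t; rewrite /= in_itv/= andbT => t0; exact: gammaf_ge_derive.
- exact: integrable_gammafB.
- by move=> t; rewrite /= in_itv/= andbT => t0; exact: gammaf_le_derive.
Qed.

Lemma eulerGamma_ge0 {R : realType} (y : R) : 0 <= eulerGamma y.
Proof. by apply: Rintegral_ge0 => t _; exact: (gammaf_ge0 y t). Qed.

Lemma derivable_eulerGamma {R : realType} (y : R) : 0 < y ->
  derivable (@eulerGamma R) y 1.
Proof. by move=> y0; apply: ex_derive; exact: is_derive_eulerGamma. Qed.

(** Gamma 2 = 1, and Gamma' >= 0 on ]2, +oo[ because
    Gamma' y >= Gamma y - Gamma (y - 1) = (y - 2) Gamma (y - 1). *)
Lemma eulerGamma_ge1 {R : realType} (y : R) : 2 <= y -> 1 <= eulerGamma y.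
Proof.
have G2 : eulerGamma 2 = 1 :> R.
  by rewrite (_ : 2 = 1 + 1 :> R) ?eulerGamma_rec// eulerGamma1 mulr1.
rewrite le_eqVlt => /predU1P[<-|y2]; first by rewrite G2.
have [| |c] := @MVT R (@eulerGamma R) ('D_1 (@eulerGamma R)) 2 y y2.
- move=> c; rewrite in_itv/= => /andP[c2 _].
  by apply/derivableP/derivable_eulerGamma; lra.
- apply: derivable_within_continuous => c; rewrite in_itv/= => /andP[c2 _].
  by apply: derivable_eulerGamma; lra.
rewrite in_itv/= => /andP[c2 _]; rewrite G2 => h.
have c1 : 1 < c by lra.
have /andP[+ _] := derive_eulerGamma_bound c c1.
have := @eulerGamma_rec R (c - 1); rewrite subrK => -> //; last by lra.
have := eulerGamma_ge0 (c - 1) => g0 d0.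
have : 0 <= 'D_1 (@eulerGamma R) c by nra.
by rewrite -subr_ge0 h => d; rewrite mulr_ge0//; lra.
Qed.

Lemma eulerGamma_gt0 {R : realType} (y : R) : 0 < y -> 0 < eulerGamma y.
Proof.
move=> y0; rewrite lt_neqAle eulerGamma_ge0 andbT eq_sym.
apply/eqP => G0; have y1 : 0 < y + 1 by lra.
have /eulerGamma_ge1 : 2 <= y + 1 + 1 by lra.
by rewrite !eulerGamma_rec// G0 !mulr0 ler10.
Qed.

(** * The reciprocal Gamma function *)

Lemma rGamma_gt0E {R : realType} (y : R) : 0 < y -> rGamma y = (eulerGamma y)^-1.
Proof.
move=> y0; rewrite /rGamma /Gamma /=.
rewrite (_ : Num.truncn (1 - y) = 0%N) ?big_ord0 ?addr0 ?divr1//.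
by apply/truncn0Pn; rewrite -ltNge; lra.
Qed.

(** The functional equation for y > 0, the way in which Gamma is extended
    elsewhere; at the poles of Gamma both sides are 0, since either y = 0 or y + 1
    is again a pole. *)
Lemma rGamma_rec {R : realType} (y : R) : rGamma y = y * rGamma (y + 1).
Proof.
have [y0|y0] := ltP 0 y.
  rewrite !rGamma_gt0E ?addr_gt0// eulerGamma_rec// invfM mulVKf// gt_eqF//.
rewrite /rGamma /Gamma /=; set n := Num.truncn (1 - (y + 1)).
have -> : Num.truncn (1 - y) = n.+1.
  rewrite (_ : 1 - y = 1 + (1 - (y + 1))); last by ring.
  by rewrite truncnD ?truncn1// nnegrE; lra.
rewrite big_ord_recl/= addr0.
rewrite (_ : y + n.+1%:R = y + 1 + n%:R); last by rewrite -natr1; ring.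
under eq_bigr do rewrite /bump/= add1n -natr1 (addrC _ 1) addrA.
by rewrite !invfM !invrK; ring.
Qed.

(** Clear for y > 0; the recurrence extends it to y > - n by induction on n. *)
Lemma derivable_rGamma {R : realType} (y : R) : derivable (@rGamma R) y 1.
Proof.
have [n] : exists n : nat, - n%:R < y.
  by exists (Num.truncn (- y)).+1; rewrite ltrNl truncnS_gt.
elim: n y => [|n IHn] y yn.
  rewrite oppr0 in yn.
  apply: (@near_eq_derivable _ _ _ (fun z => (eulerGamma z)^-1)) => //.
    by near=> z; rewrite rGamma_gt0E//; near: z; exact: lt_nbhsr.
  by apply: derivableV; [rewrite gt_eqF// eulerGamma_gt0|exact: derivable_eulerGamma].
rewrite (_ : @rGamma R = id * (@rGamma R \o (+%R^~ 1))); last first.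
  by apply/funext => z; rewrite rGamma_rec.
apply: derivableM => //.
have /IHn/derivableP h : - n%:R < y + 1 by rewrite -natr1 opprD in yn; lra.
apply: ex_derive; apply: is_derive1_comp.
Unshelve. all: end_near. Qed.

Lemma derive_rGamma_rec {R : realType} (y : R) :
  'D_1 (@rGamma R) y = rGamma (y + 1) + y * 'D_1 (@rGamma R) (y + 1).
Proof.
have h := derivableP (derivable_rGamma (y + 1)).
have : is_derive y 1 (id * (@rGamma R \o (+%R^~ 1)))
   (y *: ('D_1 (@rGamma R) (y + 1) * (1 + 0)) + rGamma (y + 1) *: 1).
  by apply: is_deriveM; apply: is_derive1_comp.
rewrite (_ : id * _ = @rGamma R); last first.
  by apply/funext => z; rewrite [RHS]rGamma_rec.
move=> /@derive_val ->; rewrite /GRing.scale/=; ring.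
Qed.

(** Here 0 <= Gamma' y <= (y - 1) Gamma y and Gamma y >= 1, while
    (1 / Gamma)' = - Gamma' / Gamma ^ 2. *)
Lemma rGamma_bound_ge2 {R : realType} (y : R) : 2 <= y ->
  `|rGamma y| <= 1 /\ `|'D_1 (@rGamma R) y| <= y.
Proof.
move=> y2; have y0 : 0 < y by lra.
have G1 := eulerGamma_ge1 y y2; have G0 : 0 < eulerGamma y by lra.
split.
  by rewrite rGamma_gt0E// normfV ger0_norm ?(ltW G0)// invf_le1.
have y1 : 1 < y by lra.
have /andP[] := derive_eulerGamma_bound y y1.
have := @eulerGamma_rec R (y - 1); rewrite subrK => -> //; last by lra.
rewrite eulerGamma_rec// => dlo dhi.
have d0 : 0 <= 'D_1 (@eulerGamma R) y.
  by apply: le_trans dlo; have := eulerGamma_ge0 (y - 1); nra.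
have -> : 'D_1 (@rGamma R) y = - (eulerGamma y) ^- 2 * 'D_1 (@eulerGamma R) y.
  rewrite (@near_eq_derive _ _ _ _ (fun z => (eulerGamma z)^-1)) ?oner_eq0//; last first.
    by near=> z; rewrite rGamma_gt0E//; near: z; exact: lt_nbhsr.
  by rewrite deriveV ?gt_eqF//; exact: derivable_eulerGamma.
rewrite normrM normrN (ger0_norm d0) normfV [`|_ ^+ 2|]ger0_norm ?exprn_ge0 ?(ltW G0)//.
rewrite ler_pdivrMl ?exprn_gt0// mulrC; apply: (@le_trans _ _ (y * eulerGamma y)).
  have : 0 <= (y - 1) * eulerGamma (y - 1) by rewrite mulr_ge0 ?eulerGamma_ge0//; lra.
  by lra.
by rewrite ler_pM2l// expr2 ler_peMr// ltW.
Unshelve. all: end_near. Qed.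

Lemma rGamma_bound_step {R : realType} (y z a b : R) : `|y| <= z ->
  `|rGamma (y + 1)| <= a /\ `|'D_1 (@rGamma R) (y + 1)| <= b ->
  `|rGamma y| <= z * a /\ `|'D_1 (@rGamma R) y| <= a + z * b.
Proof.
move=> yz [ha hb]; rewrite derive_rGamma_rec [rGamma y]rGamma_rec; split.
  by rewrite normrM ler_pM.
by apply: le_trans (ler_normD _ _) _; rewrite lerD// normrM ler_pM.
Qed.

(** Three steps of the recurrence lead from [2, +oo[ down to [-1, +oo[, each one
    multiplying the bounds by about y + 4. *)
Lemma rGamma_bound {R : realType} (y : R) : -1 <= y ->
  `|rGamma y| <= (y + 4) ^+ 3 /\ `|'D_1 (@rGamma R) y| <= 4 * (y + 4) ^+ 4.
Proof.
move=> y1; set z := y + 4.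
have z3 : 3 <= z by rewrite /z; lra.
have h3 : `|rGamma (y + 3)| <= 1 /\ `|'D_1 (@rGamma R) (y + 3)| <= z.
  by have [|? ?] := @rGamma_bound_ge2 R (y + 3); [lra|split => //; rewrite /z; lra].
have h2 : `|rGamma (y + 2)| <= z * 1 /\ `|'D_1 (@rGamma R) (y + 2)| <= 1 + z * z.
  apply: rGamma_bound_step; first by rewrite ler_norml /z; lra.
  by rewrite (_ : y + 2 + 1 = y + 3)//; ring.
have h1 : `|rGamma (y + 1)| <= z * (z * 1) /\
    `|'D_1 (@rGamma R) (y + 1)| <= z * 1 + z * (1 + z * z).
  apply: rGamma_bound_step; first by rewrite ler_norml /z; lra.
  by rewrite (_ : y + 1 + 1 = y + 2)//; ring.
have [h0 h0'] : `|rGamma y| <= z * (z * (z * 1)) /\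
    `|'D_1 (@rGamma R) y| <= z * (z * 1) + z * (z * 1 + z * (1 + z * z)).
  by apply: rGamma_bound_step => //; rewrite ler_norml /z; lra.
split; first by apply: le_trans h0 _; rewrite le_eqVlt; apply/orP; left; apply/eqP; ring.
have z2 : 1 <= z ^+ 2 by rewrite exprn_ege1//; lra.
have -> : z ^+ 4 = z ^+ 2 * z ^+ 2 by ring.
apply: le_trans h0' _; rewrite (_ : _ + _ = 3 * z ^+ 2 + z ^+ 2 * z ^+ 2); last by ring.
have : z ^+ 2 <= z ^+ 2 * z ^+ 2 by rewrite ler_peMr// (le_trans _ z2).
lra.
Qed.

(** * Dominated convergence and termwise differentiation of series *)

Lemma norm_lim_series_le_tail {R : realType} (w b : R^nat) (N : nat) :
  (forall k, `|w k| <= b k) -> cvgn (series b) ->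
  `|limn (series w)| <= \sum_(0 <= k < N) `|w k| + (limn (series b) - series b N).
Proof.
move=> wb cb.
have b0 k : 0 <= b k by exact: le_trans (wb k).
have cnw : cvgn [normed series w].
  by apply: series_le_cvg cb => // k; exact: normr_ge0.
apply: le_trans (@lim_series_norm _ R^o _ cnw) _.
apply: limr_le => //; near=> n.
have Nn : (N <= n)%N by near: n; exact: nbhs_infty_ge.
rewrite /= /series/= (big_cat_nat (leq0n N) Nn)//= lerD2l lerBrDl.
apply: (@le_trans _ _ (series b n)).
  by rewrite /series/= (big_cat_nat (leq0n N) Nn)//= lerD2l ler_sum.
apply: nondecreasing_cvgn_le => //.
by apply: nondecreasing_series => k _ _.
Unshelve. all: end_near. Qed.

(** Dominated convergence for series, along an arbitrary filter: the tails are
    small uniformly in t, and finitely many terms remain. *)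
Lemma cvg_lim_series {R : realType} {T : Type} {F : set_system T}
    {FF : ProperFilter F} (u : T -> R^nat) (l M : R^nat) :
  cvgn (series M) -> (\forall t \near F, forall k, `|u t k| <= M k) ->
  (forall k, u t k @[t --> F] --> l k) ->
  limn (series (u t)) @[t --> F] --> limn (series l).
Proof.
move=> cM uM ul.
have lM k : `|l k| <= M k.
  apply: (cvgr_to_le (cvg_norm (ul k))).
  by apply: filterS uM => t; exact.
have cl (v : R^nat) : (forall k, `|v k| <= M k) -> cvgn (series v).
  move=> vM; apply: (@normed_cvg R R^o); apply: (series_le_cvg _ _ vM cM) => k //.
  exact: le_trans (vM k).
apply/cvgrPdist_le => e e0.
have [N _ /(_ N (leqnn _)) hN] :
    \forall N \near \oo, `|limn (series M) - series M N| <= e / 4.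
  by move/cvgrPdist_le : cM; apply; rewrite divr_gt0.
have hsum : \sum_(0 <= k < N) `|l k - u t k| @[t --> F] --> (0 : R).
  have : \sum_(0 <= k < N) `|l k - u t k| @[t --> F] --> \sum_(0 <= k < N) `|l k - l k|.
    apply: (@cvg_big R nat +%R 0 xpredT (@add_continuous R)) => k _.
    by apply: cvg_norm; apply: cvgB => //; exact: cvg_cst.
  by under [X in _ --> X -> _]eq_bigr do rewrite subrr normr0;
    rewrite sumr_const_nat mul0rn.
near=> t.
have utM : forall k, `|u t k| <= M k by near: t.
rewrite -lim_seriesB; [|exact: cl..].
have c2M : cvgn (series (2 *: M)) by exact: is_cvg_seriesZ.
have w2M k : `|(l - u t) k| <= (2 *: M) k.
  rewrite -[leRHS]/(2 * M k) mulr_natl mulr2n.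
  by rewrite (le_trans (ler_normB _ _))// lerD.
apply: le_trans (norm_lim_series_le_tail (l - u t) (2 *: M) N w2M c2M) _.
have h1 : \sum_(0 <= k < N) `|l k - u t k| <= e / 2.
  by near: t; apply: (cvgr_le _ hsum); rewrite divr_gt0.
have h2 : limn (series (2 *: M)) - series (2 *: M) N <= e / 2.
  rewrite lim_seriesZ// seriesZ -scalerBr /GRing.scale/=.
  by have := ler_normlW hN; lra.
by apply: le_trans (lerD h1 h2) _; lra.
Unshelve. all: end_near. Qed.

Lemma cvg_series_shift {R : realType} (u : R^nat) : cvgn (series u) ->
  series (fun k => u k.+1) n @[n --> \oo] --> limn (series u) - u 0%N.
Proof.
move=> cu; have : series u n.+1 @[n --> \oo] --> limn (series u).
  by rewrite (cvg_shiftS (series u)).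
move=> h; rewrite (_ : series _ = (fun n => series u n.+1 - u 0%N)).
  by apply: cvgB => //; exact: cvg_cst.
by apply/funext => n; rewrite /series /= [in RHS]big_nat_recl//= addrC addKr.
Qed.

Lemma mean_value_bound {R : realType} (f f' : R -> R) (a r M y : R) :
  (forall z, `|z - a| < r -> is_derive z 1 f (f' z)) ->
  (forall z, `|z - a| < r -> `|f' z| <= M) ->
  `|y - a| < r -> `|f y - f a| <= M * `|y - a|.
Proof.
move=> df bf yar.
have main b c : b <= c -> (forall z, z \in `[b, c] -> `|z - a| < r) ->
    `|f c - f b| <= M * `|c - b|.
  move=> bc hz; have [z zbc||z zbc ->] := @MVT_segment R f f' b c bc.
  - by apply: df; apply: hz; exact: subset_itv_oo_cc.
  - apply: derivable_within_continuous => z zbc.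
    by have [] := df z (hz z zbc).
  - by rewrite normrM ler_wpM2r// bf// hz.
have r0 : 0 < r by apply: le_lt_trans yar.
move: (yar); rewrite ltr_norml => /andP[yl yr].
have [ya|/ltW ay] := leP y a.
  rewrite distrC (distrC y); apply: main => // z; rewrite in_itv/= => /andP[? ?].
  by rewrite ltr_norml; lra.
apply: main => // z; rewrite in_itv/= => /andP[? ?].
by rewrite ltr_norml; lra.
Qed.

(** By the mean value theorem the difference quotients of f k are bounded by M k,
    so dominated convergence applies to them. *)
Lemma is_derive_series {R : realType} (f f' : nat -> R -> R) (a r : R) (M : R^nat) :
  0 < r -> cvgn (series M) ->
  (forall k y, `|y - a| < r -> is_derive y 1 (f k) (f' k y)) ->
  (forall k y, `|y - a| < r -> `|f' k y| <= M k) ->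
  (forall y, `|y - a| < r -> cvgn (series (f ^~ y))) ->
  is_derive a 1 (fun y => limn (series (f ^~ y))) (limn (series (f' ^~ a))).
Proof.
move=> r0 cM df bf cf.
have aa : `|a - a| < r by rewrite subrr normr0.
have near_a : \forall h \near (0 : R)^', `|h + a - a| < r.
  by near=> h; rewrite addrK; near: h; exact: dnbhs0_lt.
pose q (h : R) k := h^-1 *: (f k (h *: 1 + a) - f k a).
have h : limn (series (q h)) @[h --> 0^'] --> limn (series (f' ^~ a)).
  apply: (cvg_lim_series q _ M cM).
  - near=> h => k; rewrite /q.
    have h0 : h != 0 by near: h; exact: nbhs_dnbhs_neq.
    have ha : `|h + a - a| < r by near: h.
    have := mean_value_bound (f k) (f' k) a r (M k) (h + a) (df k) (bf k) ha.
    rewrite addrK /GRing.scale/= mulr1 => hb.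
    by rewrite normrM normfV ler_pdivrMl ?normr_gt0// mulrC.
  - by move=> k; have [+ <-] := df k a aa; apply.
have {}h : h^-1 *: (limn (series (f ^~ (h *: 1 + a))) - limn (series (f ^~ a)))
    @[h --> 0^'] --> limn (series (f' ^~ a)).
  apply: cvg_trans h; apply: near_eq_cvg; near=> h.
  have ha : `|h *: 1 + a - a| < r by rewrite /GRing.scale/= mulr1; near: h.
  rewrite -lim_seriesB; [|exact: cf|exact: cf].
  by rewrite -lim_seriesZ//; apply: is_cvg_seriesB; exact: cf.
split; first exact: (cvgP _ h).
exact: cvg_lim h.
Unshelve. all: end_near. Qed.

(** * Series of values of the reciprocal Gamma function *)

(** From z^5 / 5! <= e^z at z = k + 1: polynomial factors in k turn into geometric
    ones, which an exponential series absorbs. *)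
Lemma pow5_le_exp {R : realType} (k : nat) :
  (k.+1%:R : R) ^+ 5 <= 120 * (expR 1 * expR 1 ^+ k).
Proof.
rewrite -exprS -expRM_natr mul1r -ler_pdivrMl//.
(* [expR_ge1Dxn] at index n bounds the power n + 1. *)
have := @expR_ge1Dxn R k.+1%:R 4 (ler0n _ _).
by rewrite (_ : 5`!%:R = 120)// => h; rewrite mulrC; lra.
Qed.

(** Common to the integral Wright function, whose parameter multiplies k, and to the
    Bessel series, whose parameter is added to k.  The arguments of 1 / Gamma must
    stay in the range where it grows polynomially, and linearly in k, over a
    neighbourhood of the point a of differentiation. *)
Section rGamma_series.
Context {R : realType}.
Variables (x C a : R) (c p q : R^nat).
Hypothesis c_le : forall k, `|c k| <= C * (`|x| ^+ k / k`!%:R).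
Hypothesis p_le : forall k, 0 <= p k <= k.+1%:R.
Hypothesis pq_le : forall k y, `|y - a| < 1 / 2 -> -1 <= p k * y + q k <= 3 * k.+1%:R.

(* If the argument z of 1 / Gamma is at most 3 (k + 1), then z + 4 <= 7 (k + 1), so
   that the bound 4 (z + 4) ^ 4 on the derivative, times the factor p k <= k + 1
   from the chain rule, is at most 4 * 7 ^ 4 * (k + 1) ^ 5. *)
Let B : R := C * (4 * 7 ^+ 4 * 120 * expR 1).
Let M : R^nat := fun k => B * ((`|x| * expR 1) ^+ k / k`!%:R).

Let cvg_M : cvgn (series M).
Proof.
exact: is_cvg_seriesZ (is_cvg_series_exp_coeff (`|x| * expR 1)).
Qed.

Let M_ge k (m : R) : m <= 4 * 7 ^+ 4 * k.+1%:R ^+ 5 -> `|c k| * m <= M k.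
Proof.
move=> hm; have c0 := le_trans (normr_ge0 _) (c_le k).
have : `|c k| * m <= `|c k| * (4 * 7 ^+ 4 * (120 * (expR 1 * expR 1 ^+ k))).
  rewrite ler_wpM2l// (le_trans hm)// ler_wpM2l ?pow5_le_exp//.
move=> /le_trans; apply; apply: (@le_trans _ _ (C * (`|x| ^+ k / k`!%:R) *
  (4 * 7 ^+ 4 * (120 * (expR 1 * expR 1 ^+ k))))).
  by rewrite ler_wpM2r// !mulr_ge0// ?expR_ge0// exprn_ge0 ?expR_ge0.
by rewrite /M /B exprMn le_eqVlt; apply/orP; left; apply/eqP; ring.
Qed.

Let term_le k y : `|y - a| < 1 / 2 -> `|c k * rGamma (p k * y + q k)| <= M k.
Proof.
move=> /(pq_le k) /andP[h1 h2]; rewrite normrM.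
have [h _] := rGamma_bound (p k * y + q k) h1.
apply: le_trans (ler_wpM2l (normr_ge0 _) h) _; apply: M_ge.
have k1 : 1 <= k.+1%:R :> R by rewrite ler1n.
apply: (@le_trans _ _ ((7 * k.+1%:R) ^+ 3)); first by rewrite lerXn2r ?nnegrE; lra.
rewrite exprMn ler_pM ?exprn_ge0//; first by rewrite -!natrX -natrM ler_nat.
by rewrite ler_weXn2l.
Qed.

Let dterm_le k y : `|y - a| < 1 / 2 ->
  `|c k * (p k * 'D_1 (@rGamma R) (p k * y + q k))| <= M k.
Proof.
move=> /(pq_le k) /andP[h1 h2]; rewrite normrM.
have [_ h] := rGamma_bound (p k * y + q k) h1.
have /andP[p0 pk] := p_le k.
apply: M_ge; rewrite normrM (ger0_norm p0).
have k1 : 1 <= k.+1%:R :> R by rewrite ler1n.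
apply: (@le_trans _ _ (k.+1%:R * (4 * (7 * k.+1%:R) ^+ 4))).
  rewrite ler_pM// (le_trans h)// ler_wpM2l// lerXn2r ?nnegrE; lra.
by rewrite le_eqVlt; apply/orP; left; apply/eqP; ring.
Qed.

Lemma is_cvg_rGamma_series y : `|y - a| < 1 / 2 ->
  cvgn (series (fun k => c k * rGamma (p k * y + q k))).
Proof.
move=> ya; apply: (@normed_cvg R R^o).
apply: (series_le_cvg _ _ (fun k => term_le k y ya) cvg_M) => k //.
exact: le_trans (term_le k y ya).
Qed.

Lemma is_cvg_derive_rGamma_series :
  cvgn (series (fun k => c k * (p k * 'D_1 (@rGamma R) (p k * a + q k)))).
Proof.
have aa : `|a - a| < 1 / 2 by rewrite subrr normr0; lra.
apply: (@normed_cvg R R^o).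
apply: (series_le_cvg _ _ (fun k => dterm_le k a aa) cvg_M) => k //.
exact: le_trans (dterm_le k a aa).
Qed.

Lemma is_derive_rGamma_series :
  is_derive a 1 (fun y => limn (series (fun k => c k * rGamma (p k * y + q k))))
    (limn (series (fun k => c k * (p k * 'D_1 (@rGamma R) (p k * a + q k))))).
Proof.
apply: (@is_derive_series R (fun k y => c k * rGamma (p k * y + q k))
  (fun k y => c k * (p k * 'D_1 (@rGamma R) (p k * y + q k))) a (1 / 2) M _ cvg_M).
- by lra.
- move=> k y _.
  have h := derivableP (derivable_rGamma (p k * y + q k)).
  have hpq : is_derive y 1 (fun y => p k * y + q k) (p k).
    have -> : (fun y => p k * y + q k) = p k *: id + cst (q k) by [].
    by apply: is_derive_eq; rewrite /GRing.scale/= mulr1 addr0.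
  have hc := @is_derive1_comp R (@rGamma R) (fun y => p k * y + q k) y _ _ h hpq.
  have -> : (fun y => c k * rGamma (p k * y + q k)) =
    c k \*: (@rGamma R \o (fun y => p k * y + q k)) by [].
  apply: (is_derive_eq (is_deriveZ (c k) hc)).
  by congr (_ * _); exact: mulrC.
- by move=> k y; exact: dterm_le.
- by move=> y; exact: is_cvg_rGamma_series.
Qed.

End rGamma_series.

(** * The Bessel-Clifford function *)

(** The Bessel-Clifford function: sqrt x ^ mu * clifford x mu = I_mu(2 sqrt x). *)
Definition clifford {R : realType} (x mu : R) : R :=
  limn (series (fun k => x ^+ k / k`!%:R * rGamma (mu + k.+1%:R))).

(** The termwise derivative of [clifford] in mu. *)
Definition dclifford {R : realType} (x mu : R) : R :=
  limn (series (fun k => x ^+ k / k`!%:R * 'D_1 (@rGamma R) (mu + k.+1%:R))).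

Section clifford.
Context {R : realType}.
Variables (x mu : R).
(* The bound leaves room for an interval of radius 1/2 around mu on which all
   arguments of 1 / Gamma remain >= -1. *)
Hypothesis mu1 : `|mu| <= 3 / 2.

Let c_le k : `|x ^+ k / k`!%:R| <= 1 * (`|x| ^+ k / k`!%:R).
Proof. by rewrite mul1r normrM normrX normfV normr_nat. Qed.

Let p_le k : 0 <= (1 : R) <= k.+1%:R.
Proof. by rewrite ler01 ler1n. Qed.

Let pq_le k y : `|y - mu| < 1 / 2 -> -1 <= 1 * y + k.+1%:R <= 3 * k.+1%:R.
Proof.
have : (1 : R) <= k.+1%:R by rewrite ler1n.
move: mu1 k.+1%:R => + K; rewrite ler_norml ltr_norml => /andP[? ?] ? /andP[? ?].
by apply/andP; split; lra.
Qed.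

Lemma is_cvg_clifford :
  cvgn (series (fun k => x ^+ k / k`!%:R * rGamma (mu + k.+1%:R))).
Proof.
have := @is_cvg_rGamma_series R x 1 mu _ (fun=> 1) (fun k => k.+1%:R) c_le pq_le mu.
rewrite subrr normr0 => /(_ ltac:(lra)).
by under eq_fun do rewrite mul1r.
Qed.

Lemma is_cvg_dclifford :
  cvgn (series (fun k => x ^+ k / k`!%:R * 'D_1 (@rGamma R) (mu + k.+1%:R))).
Proof.
have := @is_cvg_derive_rGamma_series R x 1 mu _
  (fun=> 1) (fun k => k.+1%:R) c_le p_le pq_le.
by under eq_fun do rewrite !mul1r.
Qed.

Lemma is_derive_clifford : is_derive mu 1 (clifford x) (dclifford x mu).
Proof.
have := @is_derive_rGamma_series R x 1 mu _
  (fun=> 1) (fun k => k.+1%:R) c_le p_le pq_le.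
rewrite (_ : (fun y => limn _) = clifford x); last first.
  by apply/funext => y; rewrite /clifford; under eq_fun do rewrite !mul1r.
by under eq_fun do rewrite !mul1r.
Qed.

End clifford.

(** Shifting the index, since k / k! = 1 / (k - 1)!; the term of index 0 vanishes. *)
Lemma cvg_exp_series_shift {R : realType} (x : R) (f : R^nat) :
  cvgn (series (fun k => x ^+ k / k`!%:R * f k.+1)) ->
  series (fun k => x ^+ k / k`!%:R * (k%:R * f k)) n @[n --> \oo] -->
    x * limn (series (fun k => x ^+ k / k`!%:R * f k.+1)).
Proof.
move=> cf; rewrite -cvg_shiftS.
rewrite (_ : (fun n => _) = (fun n => x * series (fun k => x ^+ k / k`!%:R * f k.+1) n)).
  by apply: cvgMl_tmp.
apply/funext => n; rewrite /series /= big_nat_recl//= mul0r mulr0 add0r mulr_sumr.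
apply: eq_bigr => k _; rewrite exprS factS natrM.
have k0 : k.+1%:R != 0 :> R by rewrite pnatr_eq0.
have f0 : k`!%:R != 0 :> R by rewrite pnatr_eq0 -lt0n fact_gt0.
by move: k.+1%:R k`!%:R k0 f0 => K F K0 F0; field; rewrite ?K0 ?F0.
Qed.

(** With g = 1 / Gamma, the coefficient g(k) = k g(k + 1) produces a shift of the
    index. *)
Lemma clifford_N1 {R : realType} (x : R) : clifford x (-1) = x * clifford x 1.
Proof.
have c1 : cvgn (series (fun k => x ^+ k / k`!%:R * rGamma ((1 : R) + k.+1%:R))).
  by apply: is_cvg_clifford; rewrite normr1; lra.
rewrite {2}/clifford.
have := @cvg_exp_series_shift R x (fun k => rGamma (1 + k%:R)) c1.
move=> /(cvg_lim _) <- //; rewrite /clifford.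
congr (limn (series _)); apply/funext => k; congr (_ * _).
rewrite (_ : -1 + k.+1%:R = k%:R); last by rewrite -natr1; ring.
by rewrite rGamma_rec (addrC 1).
Qed.

(** The derivative of g(y) = y g(y + 1), with g = 1 / Gamma, is
    g'(y) - g(y + 1) = y g'(y + 1); take y = k and shift the index. *)
Lemma dclifford_N1 {R : realType} (x : R) :
  dclifford x (-1) - clifford x 0 = x * dclifford x 1.
Proof.
have c1 : cvgn (series (fun k => x ^+ k / k`!%:R * 'D_1 (@rGamma R) ((1 : R) + k.+1%:R))).
  by apply: is_cvg_dclifford; rewrite normr1; lra.
rewrite {2}/dclifford.
have := @cvg_exp_series_shift R x (fun k => 'D_1 (@rGamma R) (1 + k%:R)) c1.
move=> /(cvg_lim _) <- //; rewrite /clifford /dclifford.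
rewrite -lim_seriesB; last 2 first.
- by apply: is_cvg_dclifford; rewrite normrN1; lra.
- by apply: is_cvg_clifford; rewrite normr0; lra.
congr (limn (series _)); apply/funext => k; rewrite !fctE -mulrBr; congr (_ * _).
rewrite (_ : -1 + k.+1%:R = k%:R); last by rewrite -natr1; ring.
rewrite derive_rGamma_rec add0r -natr1 (addrC 1); ring.
Qed.

Lemma rGamma1 {R : realType} : rGamma 1 = 1 :> R.
Proof. by rewrite rGamma_gt0E// eulerGamma1 invr1. Qed.

(** At alpha = 1 the factor k + 1 brought out by the chain rule cancels the one in
    the denominator, which leaves the series [dclifford x (-1)] from index 1 on.
    Its term of index 0 is (1 / Gamma)'(0) = 1 / Gamma 1 = 1. *)
Lemma is_derive_Wi {R : realType} (x : R) :
  is_derive (1 : R) 1 (fun alpha : R => Wi alpha 0 x) (dclifford x (-1) - 1).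
Proof.
have c_le k : `|x ^+ k.+1 / (k.+1%:R * (k.+1)`!%:R)| <= `|x| * (`|x| ^+ k / k`!%:R).
  have k1 : 1 <= k.+1%:R :> R by rewrite ler1n.
  rewrite -natrM normrM normrX normfV normr_nat exprS -mulrA.
  rewrite ler_wpM2l// ler_wpM2l ?exprn_ge0// lef_pV2 ?posrE ?ltr0n ?muln_gt0 ?fact_gt0//.
  by rewrite ler_nat factS mulnA leq_pmull.
have p_le k : 0 <= (k.+1%:R : R) <= k.+1%:R by rewrite lexx ler0n.
have pq_le k (y : R) : `|y - 1| < 1 / 2 -> -1 <= k.+1%:R * y + 0 <= 3 * k.+1%:R.
  have : (1 : R) <= k.+1%:R by rewrite ler1n.
  move: k.+1%:R => K; rewrite ltr_norml addr0 => ? /andP[? ?].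
  by apply/andP; split; nra.
have := @is_derive_rGamma_series R x `|x| 1 _
  (fun k => k.+1%:R) (fun=> 0) c_le p_le pq_le.
rewrite (_ : (fun y => limn _) = (fun alpha : R => Wi alpha 0 x)); last first.
  by apply/funext => y; rewrite /Wi; under eq_fun do rewrite (mulrC _.+1%:R y).
move=> h; apply: (is_derive_eq h) => {h}.
have cN1 := @is_cvg_dclifford R x (-1); rewrite normrN1 in cN1.
have := cvg_series_shift _ (cN1 ltac:(lra)).
rewrite expr0 fact0 divr1 mul1r addNr.
rewrite derive_rGamma_rec mul0r addr0 add0r rGamma1.
move=> /(cvg_lim _) <- //.
congr (limn (series _)); apply/funext => k.
rewrite (_ : -1 + k.+2%:R = k.+1%:R); last by rewrite -(natr1 k.+1); ring.
rewrite mulr1 addr0 mulrA; congr (_ * _).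
have k0 : k.+1%:R != 0 :> R by rewrite pnatr_eq0.
have f0 : k.+1`!%:R != 0 :> R by rewrite pnatr_eq0 -lt0n fact_gt0.
by move: k.+1%:R k.+1`!%:R k0 f0 => K F K0 F0; field; rewrite ?K0 ?F0.
Qed.

(** * Limits and derivatives of complex-valued functions of a real variable *)

Lemma normc_le_add {R : rcfType} (z : R[i]) :
  `|z| <= (`|complex.Re z| + `|complex.Im z|)%:C.
Proof.
have nR (u : R) : `|u%:C| = `|u|%:C :> R[i].
  by rewrite normc_def/= expr0n/= addr0 sqrtr_sqr.
have ni : `|'i%C| = 1 :> R[i].
  by rewrite normc_def/= expr0n/= add0r expr1n sqrtr1.
rewrite {1}[z]complexE (le_trans (ler_normD _ _))// normrM ni mul1r !nR.
by rewrite rmorphD.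
Qed.

Lemma cvg_complex {R : realType} {T : Type} {F : set_system T} {FF : Filter F}
    (a b : T -> R) (a0 b0 : R) :
  a @ F --> a0 -> b @ F --> b0 ->
  ((a t +i* b t)%C : R[i]^o) @[t --> F] --> ((a0 +i* b0)%C : R[i]^o).
Proof.
move=> /cvgrPdist_le ha /cvgrPdist_le hb; apply/cvgrPdist_le => e e0.
have d0 : 0 < complex.Re e / 2.
  by rewrite divr_gt0//; move: e0; rewrite ltcE => /andP[].
have eE : e = (complex.Re e)%:C.
  by case: e e0 {d0} => u v; rewrite ltcE/= => /andP[/eqP-> _].
near=> t.
apply: le_trans (normc_le_add _) _ => /=; rewrite eE lecR.
have h1 : `|a0 - a t| <= complex.Re e / 2 by near: t; exact: ha.
have h2 : `|b0 - b t| <= complex.Re e / 2 by near: t; exact: hb.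
lra.
Unshelve. all: end_near. Qed.

Lemma lim_series_complex {R : realType} (z : R^nat) (l : R) :
  series z @ \oo --> l ->
  limn (series (fun k => (z k)%:C) : nat -> R[i]^o) = l%:C.
Proof.
move=> zl; apply: cvg_lim; first exact: norm_hausdorff.
rewrite (_ : series _ = (fun n => (series z n +i* 0)%C)).
  by apply: cvg_complex => //; exact: cvg_cst.
by apply/funext => n; rewrite /series/= -rmorph_sum.
Qed.

(** Caratheodory's form of the derivative reduces f / g to a quotient of functions
    that are continuous at a. *)
Lemma cvg_ratio_derive {R : realType} (f g : R -> R) (a f' g' : R) :
  is_derive a 1 f f' -> is_derive a 1 g g' -> f a = 0 -> g a = 0 -> g' != 0 ->
  f y / g y @[y --> a^'] --> f' / g'.
Proof.
move=> /is_derive1_caratheodory[u [fu cu <-]] /is_derive1_caratheodory[v [gv cv <-]].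
move=> fa ga va.
have : u y / v y @[y --> a^'] --> u a / v a.
  apply: cvgM; first exact: cvg_trans (cvg_app _ (@nbhs_dnbhs _ a)) cu.
  by apply: cvgV => //; exact: cvg_trans (cvg_app _ (@nbhs_dnbhs _ a)) cv.
apply: cvg_trans; apply: near_eq_cvg; near=> y.
have ya : y - a != 0 by rewrite subr_eq0; near: y; exact: nbhs_dnbhs_neq.
have := fu y; have := gv y; rewrite fa ga !subr0 => -> ->.
by rewrite invfM mulrACA divff// mulr1.
Unshelve. all: end_near. Qed.

(** By components, because the normed module structure of R[i] is over R[i]
    itself, so that [is_derive] does not apply to functions from R to R[i]. *)
Definition is_cderive {R : realType} (f : R -> R[i]) (a : R) (l : R[i]) :=
  is_derive a 1 (fun t => complex.Re (f t)) (complex.Re l) /\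
  is_derive a 1 (fun t => complex.Im (f t)) (complex.Im l).

Lemma is_cderiveB {R : realType} (f g : R -> R[i]) (a : R) (l m : R[i]) :
  is_cderive f a l -> is_cderive g a m -> is_cderive (fun t => f t - g t) a (l - m).
Proof.
move=> [f1 f2] [g1 g2]; split.
  rewrite (_ : (fun t => _) = (fun t => complex.Re (f t)) - (fun t => complex.Re (g t))).
    by apply: is_derive_eq; rewrite raddfB.
  by apply/funext => t; rewrite raddfB.
rewrite (_ : (fun t => _) = (fun t => complex.Im (f t)) - (fun t => complex.Im (g t))).
  by apply: is_derive_eq; rewrite raddfB.
by apply/funext => t; rewrite raddfB.
Qed.

Lemma is_cderive_compN {R : realType} (f : R -> R[i]) (a : R) (l : R[i]) :
  is_cderive f (- a) l -> is_cderive (fun t => f (- t)) a (- l).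
Proof.
have key (g : R -> R) (m : R) :
    is_derive (- a) 1 g m -> is_derive a 1 (fun t => g (- t)) (- m).
  move=> gm; have := @is_derive1_comp R g -%R a _ _ gm (is_deriveNid a 1).
  by rewrite mulrN1.
by move=> [f1 f2]; split; rewrite raddfN/=; exact: key.
Qed.

Lemma is_cderiveMr {R : realType} (f : R -> R[i]) (g : R -> R) (a : R)
    (l : R[i]) (m : R) :
  is_cderive f a l -> is_derive a 1 g m ->
  is_cderive (fun t => f t * (g t)%:C) a (l * (g a)%:C + f a * m%:C).
Proof.
move=> [f1 f2] gm; split.
  have -> : (fun t => complex.Re (f t * (g t)%:C)) = (fun t => complex.Re (f t)) * g.
    by apply/funext => t; rewrite fctE; case: (f t) => u v /=; ring.
  apply: is_derive_eq; rewrite /GRing.scale/=.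
  by case: l {f1 f2} => ? ?; case: (f a) => ? ? /=; ring.
have -> : (fun t => complex.Im (f t * (g t)%:C)) = (fun t => complex.Im (f t)) * g.
  by apply/funext => t; rewrite fctE; case: (f t) => u v /=; ring.
apply: is_derive_eq; rewrite /GRing.scale/=.
by case: l {f1 f2} => ? ?; case: (f a) => ? ? /=; ring.
Qed.

Lemma is_cderive_cexp {R : realType} (w : R[i]) (a : R) :
  is_cderive (fun t => cexp (t%:C * w)) a (w * cexp (a%:C * w)).
Proof.
case: w => u v.
have E (t : R) : cexp (t%:C * (u +i* v)%C) =
    (expR (t * u) * cos (t * v) +i* (expR (t * u) * sin (t * v)))%C.
  by rewrite /cexp; simpc; rewrite /=.
have lin (c t : R) : is_derive t 1 (fun t => t * c) c.
  have -> : (fun t => t * c) = id * cst c by [].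
  by apply: is_derive_eq; rewrite /GRing.scale/= mulr0 add0r mulr1.
have de := @is_derive1_comp R expR (fun t => t * u) a _ _ (is_derive_expR _) (lin u a).
have dc := @is_derive1_comp R cos (fun t => t * v) a _ _ (is_derive_cos _) (lin v a).
have ds := @is_derive1_comp R sin (fun t => t * v) a _ _ (is_derive_sin _) (lin v a).
split.
  have -> : (fun t => complex.Re (cexp (t%:C * (u +i* v)%C))) =
      (expR \o (fun t => t * u)) * (cos \o (fun t => t * v)).
    by apply/funext => t; rewrite E.
  by apply: is_derive_eq; rewrite E /GRing.scale/=; ring.
have -> : (fun t => complex.Im (cexp (t%:C * (u +i* v)%C))) =
    (expR \o (fun t => t * u)) * (sin \o (fun t => t * v)).
  by apply/funext => t; rewrite E.
by apply: is_derive_eq; rewrite E /GRing.scale/=; ring.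
Qed.

Lemma cvg_cratio_derive {R : realType} (f : R -> R[i]) (g : R -> R) (a : R)
    (l : R[i]) (m : R) :
  is_cderive f a l -> is_derive a 1 g m -> f a = 0 -> g a = 0 -> m != 0 ->
  (f y / (g y)%:C : R[i]^o) @[y --> a^'] --> (l / m%:C : R[i]^o).
Proof.
move=> [f1 f2] gm fa ga m0.
have fa1 : complex.Re (f a) = 0 by rewrite fa.
have fa2 : complex.Im (f a) = 0 by rewrite fa.
have E (z : R[i]) (r : R) : z / r%:C = (complex.Re z / r +i* (complex.Im z / r))%C.
  by rewrite -fmorphV; case: z => u v; simpc.
rewrite E (_ : (fun y => _) =
  fun y => (complex.Re (f y) / g y +i* (complex.Im (f y) / g y))%C); last first.
  by apply/funext => y; rewrite E.
exact: cvg_complex (cvg_ratio_derive _ _ _ _ _ f1 gm fa1 ga m0)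
  (cvg_ratio_derive _ _ _ _ _ f2 gm fa2 ga m0).
Qed.

(** * The principal logarithm and square root *)

Lemma cexp0 {R : realType} : cexp 0 = 1 :> R[i].
Proof. by rewrite /cexp/= expR0 cos0 sin0 mul1r. Qed.

Lemma cexpN {R : realType} (z : R[i]) : cexp (- z) = (cexp z)^-1.
Proof.
have zN : cexp z * cexp (- z) = 1.
  case: z => u v; rewrite /cexp/= cosN sinN expRN.
  have e0 : expR u != 0 by rewrite gt_eqF ?expR_gt0.
  have := cos2Dsin2 v; move: (expR u) e0 (cos v) (sin v) => e e0 c s cs.
  simpc; apply/eqP; rewrite eq_complex/=; apply/andP; split; apply/eqP; last by ring.
  by rewrite -cs; field.
have c0 : cexp z != 0.
  by apply/eqP => z0; move: zN; rewrite z0 mul0r => /esym/eqP; rewrite oner_eq0.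
by rewrite -[RHS]mulr1 -zN mulKf.
Qed.

(** The sign chosen in [carg] is what turns sin (acos (u / r)) = |v| / r into
    v / r. *)
Lemma cexp_clog {R : realType} (z : R[i]) : z != 0 -> cexp (clog z) = z.
Proof.
move=> z0; rewrite /cexp /clog/= /carg normc_def/=.
case: z z0 => u v; rewrite eq_complex/= => uv0.
set r := Num.sqrt _.
have r0 : 0 < r.
  rewrite sqrtr_gt0 lt_neqAle addr_ge0 ?sqr_ge0// andbT eq_sym.
  by rewrite paddr_eq0 ?sqr_ge0// !sqrf_eq0.
have r2 : r ^+ 2 = u ^+ 2 + v ^+ 2 by rewrite sqr_sqrtr// addr_ge0 ?sqr_ge0.
have ur : -1 <= u / r <= 1.
  rewrite -ler_norml normrM normfV (gtr0_norm r0) ler_pdivrMr// mul1r.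
  by rewrite -(ler_pXn2r (n := 2)) ?nnegrE ?(ltW r0)// r2 real_normK
    ?num_real// lerDl sqr_ge0.
have Es : Num.sqrt (1 - (u / r) ^+ 2) = `|v| / r.
  have -> : 1 - (u / r) ^+ 2 = (v / r) ^+ 2.
    rewrite !expr_div_n r2; field.
    by rewrite -r2 expf_neq0// gt_eqF.
  by rewrite sqrtr_sqr normrM normfV (gtr0_norm r0).
rewrite lnK ?posrE//; simpc.
have [v0|v0] := leP 0 v.
  rewrite acosK ?in_itv//= sin_acos// Es ger0_norm//.
  by congr (_ +i* _)%C; rewrite mulrC divfK ?gt_eqF.
rewrite cosN sinN acosK ?in_itv//= sin_acos// Es ltr0_norm//.
by congr (_ +i* _)%C; rewrite ?mulNr ?opprK mulrC divfK ?gt_eqF.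
Qed.

(** For x < 0 the root is i sqrt |x|, whose argument pi / 2 is half of that of x. *)
Lemma clog_sqrtc {R : realType} (x : R) : x != 0 ->
  clog x%:C = 2 * clog (sqrtc x%:C).
Proof.
move=> x0.
have dbl (a b : R) : 2 * (a +i* b)%C = ((a + a) +i* (b + b))%C :> R[i].
  by rewrite mulr_natl mulr2n; simpc.
have [xpos|xneg|] := ltgtP 0 x; last by move=> /esym/eqP; rewrite (negbTE x0).
  rewrite sqrtc_sqrtr ?ler0c ?(ltW xpos)// /clog /carg !normc_def/= lexx.
  rewrite expr0n/= !addr0 !sqrtr_sqr (gtr0_norm xpos) (ger0_norm (sqrtr_ge0 _)).
  rewrite !divff ?gt_eqF ?sqrtr_gt0// acos1 dbl addr0.
  by rewrite -{1}(sqr_sqrtr (ltW xpos)) lnXn ?sqrtr_gt0// mulr2n.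
have y0 : 0 < - x by rewrite oppr_gt0.
have -> : sqrtc x%:C = (0 +i* Num.sqrt (- x))%C.
  rewrite /sqrtc /= eqxx expr0n/= addr0 sqrtr_sqr ltr0_norm// addNr mul0r sqrtr0 mul1r.
  by congr (_ +i* Num.sqrt _)%C; field.
rewrite /clog /carg !normc_def dbl/= lexx sqrtr_ge0 expr0n/= !addr0 add0r !sqrtr_sqr.
rewrite (ger0_norm (sqrtr_ge0 _)) (ltr0_norm xneg) mul0r acos0 invrN mulrN divff// acosN1.
congr (_ +i* _)%C; last by field.
by rewrite -{1}(sqr_sqrtr (ltW y0)) lnXn ?sqrtr_gt0// mulr2n.
Qed.

(** * Bessel functions at 2 sqrt x *)

Lemma besselI_sqrtc {R : realType} (x nu : R) : x != 0 -> `|nu| <= 3 / 2 ->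
  besselI nu (2%:R * sqrtc x%:C) =
  cexp (nu%:C * clog (sqrtc x%:C)) * (clifford x nu)%:C.
Proof.
move=> x0 nu1; rewrite /besselI.
have s0 : sqrtc x%:C != 0.
  by rewrite sqrtc_eq0; apply: contra x0 => /eqP[/eqP].
have := sqr_sqrtc x%:C; move: (sqrtc x%:C) s0 => s s0 s2.
have -> : 2%:R * s / 2%:R = s :> R[i].
  by rewrite mulrAC divff ?mul1r// pnatr_eq0.
rewrite /cpow (negbTE s0); congr (_ * _).
rewrite -(lim_series_complex _ _ (is_cvg_clifford x nu nu1)).
congr (limn (series _ : nat -> R[i]^o)); apply/funext => k.
rewrite /= exprM s2 -rmorphXn -rmorphM/=; congr (_%:C).
by rewrite -addrA natr1; ring.
Qed.

(** With S = clifford x, the numerator N(mu) = I_(-mu) - I_mu vanishes at 1, where it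
    is s^-1 S(-1) - s S(1), because S(-1) = x S(1) and s ^ 2 = x.  Hence
    N(mu) / sin (mu pi) tends to N'(1) / (pi cos pi). *)
Lemma besselK1_sqrtc {R : realType} (x : R) : x != 0 ->
  let s := sqrtc x%:C in let L := clog s in
  besselK 1 (2%:R * s) =
  2^-1 * (s^-1 * (L * (clifford x (-1))%:C + (dclifford x (-1))%:C) +
          s * (L * (clifford x 1)%:C + (dclifford x 1)%:C)).
Proof.
move=> x0 s L.
have s0 : s != 0.
  by rewrite sqrtc_eq0; apply: contra x0 => /eqP[/eqP].
have s2 : s ^+ 2 = x%:C by exact: sqr_sqrtc.
have E1 : cexp (1%:C * L) = s by rewrite mul1r cexp_clog.
have EN1 : cexp ((-1)%:C * L) = s^-1 by rewrite rmorphN1 mulN1r cexpN cexp_clog.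
have n1 : `|1 : R| <= 3 / 2 by rewrite normr1; lra.
have nN1 : `|-1 : R| <= 3 / 2 by rewrite normrN1; lra.
pose f mu := cexp (mu%:C * L) * (clifford x mu)%:C.
pose N mu := f (- mu) - f mu.
have df1 : is_cderive f 1 (L * s * (clifford x 1)%:C + s * (dclifford x 1)%:C).
  have := is_cderiveMr _ _ _ _ _ (is_cderive_cexp L 1) (is_derive_clifford x 1 n1).
  by rewrite E1.
have dfN1 : is_cderive f (-1)
    (L * s^-1 * (clifford x (-1))%:C + s^-1 * (dclifford x (-1))%:C).
  have := is_cderiveMr _ _ _ _ _ (is_cderive_cexp L (-1)) (is_derive_clifford x (-1) nN1).
  by rewrite EN1.
have dN := is_cderiveB _ _ _ _ _ (is_cderive_compN _ _ _ dfN1) df1.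
have N1 : N 1 = 0.
  rewrite /N /f E1 EN1 clifford_N1 rmorphM/= -s2; field; exact: s0.
have dsin : is_derive (1 : R) 1 (fun mu => sin (mu * pi)) (- pi).
  have lin : is_derive (1 : R) 1 (fun t => t * pi) pi.
    have -> : (fun t : R => t * pi) = id * cst pi by [].
    by apply: is_derive_eq; rewrite /GRing.scale/= mulr0 add0r mulr1.
  have := @is_derive1_comp R sin (fun t => t * pi) 1 _ _ (is_derive_sin _) lin.
  by rewrite mul1r cospi mulN1r.
have sin1 : sin (1 * pi) = 0 :> R by rewrite mul1r sinpi.
have pi0 : - pi != 0 :> R by rewrite oppr_eq0 gt_eqF// pi_gt0.
have h := cvg_cratio_derive N _ _ _ _ dN dsin N1 sin1 pi0.
rewrite /besselK (_ : 1 \is a Num.int); last by rewrite rpred1.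
have hK : (besselK_nonint mu (2%:R * s) : R[i]^o) @[mu --> (1 : R)^'] -->
    ((pi / 2%:R)%:C * ((- (L * s^-1 * (clifford x (-1))%:C + s^-1 * (dclifford x (-1))%:C)
     - (L * s * (clifford x 1)%:C + s * (dclifford x 1)%:C)) / (- pi)%:C) : R[i]^o).
  apply: cvg_trans (cvgMl_tmp (a := (pi / 2%:R)%:C) h).
  apply: near_eq_cvg; near=> mu.
  have mu1 : `|mu - 1| < 1 / 2.
    near: mu; apply: nbhs_dnbhs; exists (1 / 2) => /=; first by lra.
    by move=> y /=; rewrite distrC.
  have mu32 : `|mu| <= 3 / 2.
    by move: mu1; rewrite ltr_norml ler_norml => /andP[? ?]; apply/andP; split; lra.
  by rewrite /besselK_nonint !besselI_sqrtc ?normrN// mulrA.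
rewrite (cvg_lim _ hK); last exact: norm_hausdorff.
rewrite rmorphN !rmorphM fmorphV rmorph_nat/=.
have piC : (pi : R)%:C != 0 by rewrite fmorph_eq0 gt_eqF// pi_gt0.
by move: pi%:C piC => p p0; field; rewrite s0 p0.
Unshelve. all: end_near. Qed.

Theorem theorem3p2 (R : realType) (x : R) (hx : x != 0) :
  let s : R[i] := sqrtc x%:C in
  derivable (fun alpha : R => Wi alpha 0 x) 1 1 /\
  (derive1 (fun alpha : R => Wi alpha 0 x) 1)%:C =
    1 / 2%:R * (besselI 0 (2%:R * s) -
                s * (clog x%:C * besselI 1 (2%:R * s) -
                     2%:R * besselK 1 (2%:R * s))) - 1.
Proof.
move=> s; have dWi := is_derive_Wi x.
split; first by have [] := dWi.
rewrite derive1E (@derive_val _ _ _ _ _ _ _ dWi).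
have s0 : s != 0.
  by rewrite sqrtc_eq0; apply: contra hx => /eqP[/eqP].
have s2 : s ^+ 2 = x%:C by exact: sqr_sqrtc.
rewrite besselK1_sqrtc// !besselI_sqrtc ?normr0 ?normr1//; last by lra.
rewrite -/s clog_sqrtc// -/s mul0r cexp0 !mul1r cexp_clog// clifford_N1.
have -> : dclifford x (-1) = clifford x 0 + x * dclifford x 1.
  by rewrite -dclifford_N1 addrC subrK.
rewrite rmorphB rmorph1 !rmorphD !rmorphM/= -s2.
by field; exact: s0.
Qed.
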